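(* Let $A$ be a $C^*$-algebra and let $H$ be any Hilbert $A$-module. Then $H$ is projective with respect to bounded module maps with adjoints, in the following sense. (1) If $H_1$ is a Hilbert $A$-module and $\phi\in L(H_1,H)$ is surjective, then there is $\psi\in L(H,H_1)$ such that $\phi\circ\psi=\mathrm{id}_H$. (2) If $H_2$ and $H_3$ are Hilbert $A$-modules, $\phi_1\in L(H_2,H_3)$ is surjective and $\phi_2\in L(H,H_3)$, then there exists $\psi\in L(H,H_2)$ such that $\phi_1\circ\psi=\phi_2$.
   Context: Hilbert $A$-modules are right modules with $A$-valued inner product. $L(H_1,H_2)$ is the set of all bounded $A$-module maps $T:H_1\to H_2$ that have an adjoint, i.e. for which there is a bounded module map $T^*:H_2\to H_1$ with $\langle Tx,y\rangle=\langle x,T^*y\rangle$ for all $x\in H_1$, $y\in H_2$. *)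

(* Defs.v *)
From HB Require Import structures.
From mathcomp Require Import all_boot all_order all_algebra.
From mathcomp Require Import complex.
From mathcomp Require Import all_classical all_reals all_analysis.

Set Implicit Arguments.
Unset Strict Implicit.
Unset Printing Implicit Defensive.

Import Order.TTheory GRing.Theory Num.Theory.
Import numFieldNormedType.Exports.

Local Open Scope ring_scope.
Local Open Scope complex_scope.

(* C*-algebras are not assumed to be unital, so the product is that of the
   library's semigroups (notation in group_scope) rather than that of its
   rings.  Norms of normed modules over R[i] take values in R[i]; they are
   nonnegative, hence real. *)
HB.mixin Record isCStarAlgebra (R : realType) A
    of CompleteNormedModule R[i] A & Semigroup A := {
  star : A -> A;
  cstar_mulDl : forall a b c : A, ((a + b)%R * c)%g = (a * c)%g + (b * c)%g;
  cstar_mulDr : forall a b c : A, (a * (b + c)%R)%g = (a * b)%g + (a * c)%g;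
  cstar_scaleAl : forall (k : R[i]) (a b : A),
    ((k *: a)%R * b)%g = k *: (a * b)%g;
  cstar_scaleAr : forall (k : R[i]) (a b : A),
    (a * (k *: b)%R)%g = k *: (a * b)%g;
  cstar_normM : forall a b : A, `|(a * b)%g| <= `|a| * `|b|;
  starK : involutive star;
  starD : forall a b : A, star (a + b) = star a + star b;
  starZ : forall (k : R[i]) (a : A), star (k *: a) = k^* *: star a;
  starM : forall a b : A, star (a * b)%g = (star b * star a)%g;
  cstar_identity : forall a : A, `|(star a * a)%g| = `|a| ^+ 2
}.

#[short(type="cstarAlgType")]
HB.structure Definition CStarAlgebra (R : realType) :=
  {A of isCStarAlgebra R A & CompleteNormedModule R[i] A & Semigroup A}.

Definition cstar_nonneg (R : realType) (A : cstarAlgType R) (a : A) : Prop :=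
  exists b : A, a = (star b * b)%g.

(* The inner product is linear in the second variable and, by
   inner_conj_sym, conjugate-linear in the first.  The norm of the underlying
   complete normed module is the one induced by the inner product, so
   inner_norm also gives definiteness. *)
HB.mixin Record isHilbertModule (R : realType) (A : cstarAlgType R) H
    of CompleteNormedModule R[i] H := {
  ract : H -> A -> H;
  ractDl : forall (x y : H) (a : A), ract (x + y) a = ract x a + ract y a;
  ractDr : forall (x : H) (a b : A), ract x (a + b) = ract x a + ract x b;
  ractA : forall (x : H) (a b : A), ract x (a * b)%g = ract (ract x a) b;
  ractZl : forall (k : R[i]) (x : H) (a : A),
    ract (k *: x) a = k *: ract x a;
  ractZr : forall (k : R[i]) (x : H) (a : A),
    ract x (k *: a) = k *: ract x a;
  inner : H -> H -> A;
  innerDr : forall x y z : H, inner x (y + z) = inner x y + inner x z;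
  innerZr : forall (k : R[i]) (x y : H), inner x (k *: y) = k *: inner x y;
  inner_ractr : forall (x y : H) (a : A),
    inner x (ract y a) = (inner x y * a)%g;
  inner_conj_sym : forall x y : H, star (inner x y) = inner y x;
  inner_nonneg : forall x : H, cstar_nonneg (inner x x);
  inner_norm : forall x : H, `|x| ^+ 2 = `|inner x x|
}.

#[short(type="hilbertModType")]
HB.structure Definition HilbertModule (R : realType) (A : cstarAlgType R) :=
  {H of isHilbertModule R A H & CompleteNormedModule R[i] H}.

Section BoundedModuleMaps.
Context {R : realType} {A : cstarAlgType R}.

Definition bounded_module_map (H1 H2 : hilbertModType A)
    (T : {linear H1 -> H2}) : Prop :=
  (forall (x : H1) (a : A), T (ract x a) = ract (T x) a) /\
  (exists M : R, forall x : H1, `|T x| <= M%:C * `|x|).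

(* Membership in L(H1, H2). *)
Definition adjointable (H1 H2 : hilbertModType A)
    (T : {linear H1 -> H2}) : Prop :=
  bounded_module_map T /\
  (exists S : {linear H2 -> H1}, bounded_module_map S /\
     forall (x : H1) (y : H2), inner (T x) y = inner x (S y)).

End BoundedModuleMaps.

(* Main.v *)
(* A surjective phi makes the set of y with |phi^* y| <= 1 weakly bounded, hence
   bounded, so phi^* is bounded below and so is the self-adjoint T = phi phi^*.
   Since |(T + i t) x| >= t |x| for every real t, the maps T + i t (t >= 0) are
   bounded below uniformly in t, and a continuity argument carries surjectivity
   from large t to t = 0.  Then psi = phi^* T^-1 is an adjointable right inverse
   of phi.  Norms are only estimated through polarization, so no positivity
   theory of C^*-algebras is involved. *)
Require Import Defs.
From HB Require Import structures.
From mathcomp Require Import all_boot all_order all_algebra.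
From mathcomp Require Import complex.
From mathcomp Require Import all_classical all_reals all_analysis.
From mathcomp Require Import ring lra.

Set Implicit Arguments.
Unset Strict Implicit.
Unset Printing Implicit Defensive.

Import Order.TTheory GRing.Theory Num.Theory.
Import numFieldNormedType.Exports.

Local Open Scope ring_scope.
Local Open Scope complex_scope.

(** * The norm as a real number *)

Section RealNorm.
Context {R : realType} {V : normedModType R[i]}.
Implicit Types x y : V.

(** Library norms lie in [R[i]]; taking real parts moves all estimates into the ordered field
    [R]. *)
Definition rnorm x : R := complex.Re `|x|.

Lemma rnormE x : `|x| = (rnorm x)%:C.
Proof. by rewrite /rnorm RRe_real// ger0_real. Qed.

Lemma rnorm_ge0 x : 0 <= rnorm x.
Proof. by rewrite -ler0c -rnormE. Qed.

Lemma rnorm0 : rnorm 0 = 0.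
Proof. by rewrite /rnorm normr0. Qed.

Lemma rnorm_gt0 x : (0 < rnorm x) = (x != 0).
Proof. by rewrite -ltcR -rnormE normr_gt0. Qed.

Lemma rnormN x : rnorm (- x) = rnorm x.
Proof. by rewrite /rnorm normrN. Qed.

Lemma rnorm_distC x y : rnorm (x - y) = rnorm (y - x).
Proof. by rewrite /rnorm distrC. Qed.

Lemma ler_rnormD x y : rnorm (x + y) <= rnorm x + rnorm y.
Proof. by rewrite -lecR rmorphD/= -!rnormE ler_normD. Qed.

Lemma ler_rnormB x y : rnorm (x - y) <= rnorm x + rnorm y.
Proof. by rewrite (le_trans (ler_rnormD _ _))// rnormN. Qed.

Lemma lerB_rnormD x y : rnorm x - rnorm y <= rnorm (x + y).
Proof. by rewrite lerBlDr -{1}(addrK y x) ler_rnormB. Qed.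

Lemma ler_rnorm_distD y x z : rnorm (x - z) <= rnorm (x - y) + rnorm (y - z).
Proof. by rewrite -{1}(subrK y x) -addrA ler_rnormD. Qed.

Lemma rnormZ (k : R[i]) x : rnorm (k *: x) = complex.Re `|k| * rnorm x.
Proof.
have -> : `|k| = (complex.Re `|k|)%:C by rewrite RRe_real// ger0_real.
rewrite /= {1}/rnorm normrZ rnormE.
have -> : `|k| = (complex.Re `|k|)%:C by rewrite RRe_real// ger0_real.
by rewrite -rmorphM.
Qed.

Lemma rnormZr (r : R) x : rnorm (r%:C *: x) = `|r| * rnorm x.
Proof. by rewrite rnormZ normc_def/= expr0n addr0 sqrtr_sqr. Qed.

Lemma rnormZi (r : R) x : rnorm ((r *i) *: x) = `|r| * rnorm x.
Proof. by rewrite rnormZ normc_def/= expr0n add0r sqrtr_sqr. Qed.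

End RealNorm.

(** * Geometric convergence, fixed points, perturbation of surjective maps *)

Section Completeness.
Context {R : realType} {V : completeNormedModType R[i]}.
Local Open Scope classical_set_scope.

Lemma geometric_cauchy (u : nat -> V) (C q : R) : 0 <= q < 1 ->
  (forall n, rnorm (u n.+1 - u n) <= C * q ^+ n) ->
  exists l, forall n, rnorm (l - u n) <= C * q ^+ n / (1 - q).
Proof.
move=> /andP[q0 q1] uq.
have q1' : 0 < 1 - q by rewrite subr_gt0.
have C0 : 0 <= C by have := uq 0%N; rewrite expr0 mulr1; apply/le_trans/rnorm_ge0.
have dist n m : rnorm (u (n + m)%N - u n) <= C * q ^+ n / (1 - q).
  (* The exact geometric partial sum, unlike the cruder bound, is reproduced by induction on [m]. *)
  apply: (@le_trans _ _ (C * q ^+ n * (1 - q ^+ m) / (1 - q))).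
    elim: m => [|m ih]; first by rewrite addn0 subrr rnorm0 expr0 subrr mulr0 mul0r.
    rewrite addnS; apply: (le_trans (ler_rnorm_distD (u (n + m)%N) _ _)).
    apply: (le_trans (lerD (uq _) ih)).
    rewrite exprD exprS le_eqVlt; apply/orP; left; apply/eqP.
    by field; rewrite gt_eqF.
  rewrite ler_pM2r ?invr_gt0//; apply: ler_piMr; first by rewrite mulr_ge0// exprn_ge0.
  by rewrite gerBl exprn_ge0.
have small (e : R) : 0 < e -> exists N, C * q ^+ N / (1 - q) < e.
  move=> e0.
  have := @cvg_geometric R (C / (1 - q)) q; rewrite ger0_norm// => /(_ q1).
  move=> /cvgrPdist_lt/(_ e e0)[N _ /(_ N (leqnn N))].
  rewrite /= sub0r normrN => /(le_lt_trans (ler_norm _)) h.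
  by exists N; rewrite mulrAC.
have : cvg (u @ \oo).
  apply: cauchy_cvg; apply: cauchy_exP => e e0.
  have eE : e = (complex.Re e)%:C by rewrite RRe_real// gtr0_real.
  have [N Ne] := small (complex.Re e) ltac:(by rewrite -ltcR -eE).
  exists (u N); rewrite /fmapE -ball_normE; exists N => // m /= Nm.
  rewrite eE rnormE ltcR rnorm_distC -(subnKC Nm).
  exact: le_lt_trans (dist _ _) Ne.
move=> /cvg_ex[l ul]; exists l => n.
apply/ler_addgt0Pr => e e0.
have e0' : 0 < e%:C by rewrite ltcR.
move/cvgrPdist_lt : ul => /(_ _ e0')[N _ /(_ (n + N)%N (leq_addl _ _))] /=.
rewrite rnormE ltcR => h.
apply: (le_trans (ler_rnorm_distD (u (n + N)%N) _ _)).
by rewrite addrC lerD// ltW.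
Qed.

(** Banach's fixed point theorem: the iterates of [f] from 0 converge geometrically. *)
Lemma contraction_fixpoint (f : V -> V) (q : R) : 0 <= q < 1 ->
  (forall x y, rnorm (f x - f y) <= q * rnorm (x - y)) -> exists x, f x = x.
Proof.
move=> /[dup] q01 /andP[q0 q1] fq.
pose u n := iter n f 0.
have uq n : rnorm (u n.+1 - u n) <= rnorm (f 0) * q ^+ n.
  elim: n => [|n ih]; first by rewrite /= subr0 expr0 mulr1.
  by rewrite (le_trans (fq _ _))// exprS mulrCA ler_wpM2l.
have [l ul] := geometric_cauchy q01 uq; exists l.
apply/eqP; rewrite -subr_eq0 -[_ == 0]negbK -rnorm_gt0 -leNgt.
apply/ler_addgt0Pr => e e0; rewrite add0r.
(* The factor 2 pays for the distances from [u N.+1] to [f l] and to [l]. *)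
pose C := rnorm (f 0) / (1 - q) * 2.
have := @cvg_geometric R C q; rewrite ger0_norm// => /(_ q1).
move=> /cvgrPdist_lt/(_ e e0)[N _ /(_ N (leqnn N))].
rewrite /= sub0r normrN => /(le_lt_trans (ler_norm _))/ltW; apply: le_trans.
apply: (le_trans (ler_rnorm_distD (u N.+1) _ _)).
rewrite /C mulrAC mulr_natr mulr2n; apply: lerD.
  rewrite (le_trans (fq _ _))// (le_trans (ler_piMl _ (ltW q1))) ?rnorm_ge0//.
  by rewrite mulrAC ul.
rewrite rnorm_distC (le_trans (ul _))// mulrAC.
rewrite ler_wpM2l ?divr_ge0 ?rnorm_ge0 ?subr_ge0 ?(ltW q1)//.
by rewrite exprS ler_piMl ?exprn_ge0// ltW.
Qed.

(* For a right inverse g of U, a solution of V x = z is x = g w, where w is a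
   fixed point of the contraction w |-> z - (V - U)(g w). *)
Lemma perturbed_surjective (W : zmodType) (U T : W -> V) (q : R) :
  0 <= q < 1 -> {morph U : x y / x - y} -> {morph T : x y / x - y} ->
  (forall x, rnorm (T x - U x) <= q * rnorm (U x)) ->
  (forall z, exists x, U x = z) -> forall z, exists x, T x = z.
Proof.
move=> q01 UB TB TU /choice[g gK] z.
have [|w ww] := @contraction_fixpoint (fun w => z - (T (g w) - U (g w))) q q01.
  move=> x y.
  have zB (a b : V) : z - a - (z - b) = - (a - b).
    by rewrite opprB addrC addrA subrK opprB.
  have TUB : T (g x) - U (g x) - (T (g y) - U (g y)) =
            T (g x - g y) - U (g x - g y).
    by rewrite TB UB !opprB [U (g y) - _]addrC addrACA [- U _ + _]addrC.
  by rewrite zB rnormN TUB (le_trans (TU _))// UB !gK.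
exists (g w); move: ww; rewrite gK opprB addrCA -[X in _ = X]addr0.
by move=> /addrI/subr0_eq.
Qed.

End Completeness.

(** * Inner product estimates and uniform boundedness *)

Section InnerProduct.
Context {R : realType} {A : cstarAlgType R} {H : hilbertModType A}.
Implicit Types x y z : H.

Lemma innerDl x y z : inner (x + y) z = inner x z + inner y z.
Proof. by rewrite -inner_conj_sym innerDr starD !inner_conj_sym. Qed.

Lemma innerZl (k : R[i]) x y : inner (k *: x) y = k^* *: inner x y.
Proof. by rewrite -inner_conj_sym innerZr starZ inner_conj_sym. Qed.

Lemma inner0l x : inner 0 x = 0.
Proof. by rewrite -(scale0r (0 : H)) innerZl conjC0 scale0r. Qed.

Lemma inner0r x : inner x 0 = 0.
Proof. by rewrite -(scale0r (0 : H)) innerZr scale0r. Qed.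

Lemma innerBr x y z : inner x (y - z) = inner x y - inner x z.
Proof. by rewrite innerDr -scaleN1r innerZr scaleN1r. Qed.

Lemma rnorm_inner_self x : rnorm (inner x x) = rnorm x ^+ 2.
Proof.
apply: complexI; have := inner_norm x.
by rewrite !rnormE -rmorphXn => ->.
Qed.

(* Polarization: the constant 6 suffices here, and the sharp constant 1 would
   require the order structure of A. *)
Lemma rnorm_inner_le x y : rnorm (inner x y) <= 6 * rnorm x * rnorm y.
Proof.
(* The bound is 4 + 1 + 1, from the three inner squares in the identity below. *)
have sym (u v : H) : rnorm u <= 1 -> rnorm v <= 1 ->
    rnorm (inner u v + inner v u) <= 6.
  move=> u1 v1.
  have -> : inner u v + inner v u =
      inner (u + v) (u + v) - inner u u - inner v v.
    rewrite innerDl !innerDr.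
    rewrite -[X in _ = X - _ - _]addrA [X in _ = X - _ - _]addrC addrK.
    by rewrite addrA addrK.
  apply: (le_trans (ler_rnormB _ _)).
  apply: (le_trans (lerD (ler_rnormB _ _) (lexx _))).
  rewrite !rnorm_inner_self.
  have := ler_rnormD u v; have := rnorm_ge0 u; have := rnorm_ge0 v.
  have := rnorm_ge0 (u + v); nra.
(* Using ['i *: v] for [v] in the symmetric sum and multiplying by [- 'i] gives
   [inner u v - inner v u]. Adding the original sum leaves twice [inner u v], of norm at most 6 +
   6. *)
have unit (u v : H) : rnorm u <= 1 -> rnorm v <= 1 -> rnorm (inner u v) <= 6.
  move=> u1 v1; have iv1 : rnorm ('i *: v) <= 1 by rewrite rnormZi normr1 mul1r.
  have /le_trans := ler_rnormD (inner u v + inner v u)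
    ((- 'i) *: (inner u ('i *: v) + inner ('i *: v) u)).
  have -> : inner u v + inner v u
      + (- 'i) *: (inner u ('i *: v) + inner ('i *: v) u) =
      2%:C *: inner u v.
    rewrite innerZr innerZl scalerDr !scalerA mulNr -expr2 sqr_i opprK scale1r.
    have -> : - 'i * ('i : R[i])^* = -1.
      by apply/eqP; rewrite eq_complex /=; apply/andP; split; apply/eqP; ring.
    rewrite scaleN1r [inner u v - _]addrC addrA addrK.
    by rewrite (rmorph_nat (real_complex R)) scaler_nat mulr2n.
  rewrite scaleNr rnormN rnormZi rnormZr normr1 ger0_norm// mul1r.
  move=> /(_ _ (lerD (sym _ _ u1 v1) (sym _ _ u1 iv1))); lra.
have [->|x0] := eqVneq x 0; first by rewrite inner0l !rnorm0 mulr0 mul0r.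
have [->|y0] := eqVneq y 0; first by rewrite inner0r !rnorm0 mulr0.
rewrite -rnorm_gt0 in x0; rewrite -rnorm_gt0 in y0.
have normalized (z : H) : 0 < rnorm z -> rnorm ((rnorm z)^-1%:C *: z) <= 1.
  by move=> z0; rewrite rnormZr gtr0_norm ?invr_gt0// mulVf ?gt_eqF.
have := unit _ _ (normalized x x0) (normalized y y0).
rewrite innerZl innerZr conj_Creal ?complex_real// !rnormZr !gtr0_norm ?invr_gt0//.
by rewrite mulrA mulrC -invfM ler_pdivrMr ?mulr_gt0// mulrA.
Qed.

(* Gliding hump: with norms of y n in S growing like 13 ^ n, signed steps of
   length 13 ^ - n along y n are chosen so that inner (y n) stays large at every
   later point; the base 13 beats the constant 6 of rnorm_inner_le. *)
Lemma weakly_bounded_bounded (S : set H) :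
  (forall z, exists M, forall y, S y -> rnorm (inner y z) <= M) ->
  exists M, forall y, S y -> rnorm y <= M.
Proof.
move=> Sweak; apply: contrapT => /forallNP Sunbounded.
have big (M : R) : exists y, S y /\ M < rnorm y.
  by have /existsNP[y /not_implyP[Sy /negP]] := Sunbounded M; rewrite -ltNge; exists y.
have /choice[y ybig] : forall n, exists y, S y /\ 2 * n%:R * 13 ^+ n < rnorm y.
  by move=> n; exact: big.
pose q : R := 13^-1.
have q01 : 0 <= q < 1 by rewrite /q; lra.
have qn0 n : 0 <= q ^+ n by rewrite exprn_ge0// /q.
have y0 n : 0 < rnorm (y n).
  by apply: le_lt_trans (ybig n).2; rewrite !mulr_ge0 ?exprn_ge0.
pose d n := (q ^+ n / rnorm (y n))%:C *: y n.
have dn n : rnorm (d n) = q ^+ n.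
  rewrite rnormZr ger0_norm ?divfK ?gt_eqF//.
  by rewrite divr_ge0 ?rnorm_ge0.
have yd n : rnorm (inner (y n) (d n)) = q ^+ n * rnorm (y n).
  rewrite innerZr rnormZr ger0_norm; last first.
    by rewrite divr_ge0 ?rnorm_ge0.
  by rewrite rnorm_inner_self expr2 mulrA divfK ?gt_eqF.
(* One of [x + d n], [x - d n] works: their inner products with [y n] differ by twice
   [inner (y n) (d n)], so they cannot both be small. *)
have step n x : exists x', rnorm (x' - x) = q ^+ n /\
    q ^+ n * rnorm (y n) <= rnorm (inner (y n) x').
  have [h|h] := leP (q ^+ n * rnorm (y n)) (rnorm (inner (y n) (x + d n))).
    by exists (x + d n); rewrite addrC addKr dn.
  exists (x - d n); rewrite addrC addKr rnormN dn; split=> //.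
  have xd : x + d n - (x - d n) = 2%:C *: d n.
    by rewrite opprB addrC addrA subrK (rmorph_nat (real_complex R)) scaler_nat mulr2n.
  have := ler_rnormB (inner (y n) (x + d n)) (inner (y n) (x - d n)).
  by rewrite -innerBr xd innerZr rnormZr yd ger0_norm//; lra.
have /choice[s sP] := fun p : nat * H => step p.1 p.2.
pose u := fix u n := if n is m.+1 then s (m, u m) else 0.
have uS n : rnorm (u n.+1 - u n) = q ^+ n by rewrite (sP (n, u n)).1.
have [|l lu] := @geometric_cauchy R H u 1 q q01.
  by move=> n; rewrite uS mul1r.
have [M MS] := Sweak l.
have [N MN] : exists N : nat, M < N%:R.
  by exists (Num.truncn M).+1; rewrite truncnS_gt.
have := MS _ (ybig N).1; apply/negP; rewrite -ltNge (lt_le_trans MN)//.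
have h1 : q ^+ N * rnorm (y N) <= rnorm (inner (y N) (u N.+1)).
  exact: (sP (N, u N)).2.
have h2 := lerB_rnormD (inner (y N) (u N.+1)) (inner (y N) (l - u N.+1)).
have h3 := rnorm_inner_le (y N) (l - u N.+1).
have h4 := lu N.+1.
rewrite -innerDr [u _ + _]addrC subrK in h2.
have h5 : N%:R <= q ^+ N * rnorm (y N) / 2.
  have qN : 13 ^+ N * q ^+ N = 1 by rewrite -exprMn /q divff// expr1n.
  have := ler_wpM2r (qn0 N) (ltW (ybig N).2).
  by rewrite -!mulrA qN mulr1; lra.
(* The steps after [u N.+1] add up to at most [q ^+ N.+1 / (1 - q) = q ^+ N / 12], so they destroy
   at most half of the hump; by [h5] the other half is at least [N], hence above [M]. *)
have h6 : 6 * rnorm (y N) * rnorm (l - u N.+1) <= q ^+ N * rnorm (y N) / 2.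
  apply: (@le_trans _ _ (6 * rnorm (y N) * (q ^+ N / 12))).
    rewrite ler_wpM2l ?mulr_ge0 ?rnorm_ge0// (le_trans h4)//.
    have qE : q / (1 - q) = 12^-1 by rewrite /q; field.
    by rewrite mul1r exprS mulrC mulrA [_^-1 * _]mulrC qE mulrC.
  lra.
lra.
Qed.

End InnerProduct.

(** * Surjectivity of self-adjoint maps that are bounded below *)

Section Surjectivity.
Context {R : realType} {A : cstarAlgType R} {H : hilbertModType A}.
Variable T : {linear H -> H}.
Hypothesis T_self_adjoint : forall x y, inner (T x) y = inner x (T y).

(** The cross terms carry the factors i r and -i r and cancel by self-adjointness. *)
Lemma rnorm_sqr_addi (r : R) x :
  rnorm (x + (r *i) *: T x) ^+ 2 <= rnorm x ^+ 2 + r ^+ 2 * rnorm (T x) ^+ 2.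
Proof.
rewrite -!rnorm_inner_self.
have -> : inner (x + (r *i) *: T x) (x + (r *i) *: T x) =
    inner x x + (r ^+ 2)%:C *: inner (T x) (T x).
  rewrite innerDl !innerDr !innerZl !innerZr T_self_adjoint -addrA; congr (_ + _).
  have conji : (r *i : R[i])^*%R = - (r *i).
    by apply/eqP; rewrite eq_complex /= oppr0 !eqxx.
  rewrite conji scaleNr addNKr scalerA; congr (_ *: _).
  by apply/eqP; rewrite eq_complex /=; apply/andP; split; apply/eqP; ring.
apply: (le_trans (ler_rnormD _ _)).
by rewrite lerD2l rnormZr ger0_norm ?sqr_ge0.
Qed.

(* To first order in s, 1 + i s T is an isometry, whereas
   (1 + i s T) x = (1 + s t) x + i s (T + i t) x. *)
Lemma rnorm_add_imaginary (t : R) x : t * rnorm x <= rnorm (T x + (t *i) *: x).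
Proof.
rewrite leNgt; apply/negP.
set N := rnorm x; set m := rnorm (T x); set D := rnorm _ => DN.
have [x0|x0] := eqVneq x 0.
  by move: DN; rewrite /N x0 rnorm0 mulr0 ltNge rnorm_ge0.
have N0 : 0 < N by rewrite rnorm_gt0.
(* Squaring [h3] and comparing with [h2] cancels [N ^+ 2]; what remains is divided by [s]. *)
have key (s : R) : 0 < s -> 2 * (t * N - D) * N <= s * m ^+ 2.
  move=> s0.
  have split : (1 + s * t)%:C *: x =
      (x + (s *i) *: T x) - (s *i) *: (T x + (t *i) *: x).
    rewrite scalerDr opprD addrA addrK scalerA -scaleNr -[X in _ = X + _]scale1r -scalerDl.
    congr (_ *: _).
    by apply/eqP; rewrite eq_complex /=; apply/andP; split; apply/eqP; ring.
  have := ler_rnormB (x + (s *i) *: T x) ((s *i) *: (T x + (t *i) *: x)).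
  rewrite -split rnormZr rnormZi (gtr0_norm s0) -/N -/D => h1.
  have h2 := rnorm_sqr_addi s x; rewrite -/N -/m in h2.
  set B := rnorm (x + _) in h1 h2.
  have h3 : N + s * (t * N - D) <= B.
    have := ler_wpM2r (ltW N0) (ler_norm (1 + s * t)); lra.
  have h4 : 0 < s * (t * N - D) by rewrite mulr_gt0// subr_gt0.
  have h5 : (N + s * (t * N - D)) ^+ 2 <= B ^+ 2.
    by rewrite ler_sqr ?nnegrE ?rnorm_ge0// ltW// addr_gt0.
  rewrite -(ler_pM2l s0).
  have := sqr_ge0 (s * (t * N - D)); nra.
have e0 : 0 < (t * N - D) * N by rewrite mulr_gt0// subr_gt0.
set e := (t * N - D) * N in e0.
have m1 : 0 < m ^+ 2 + 1 by rewrite ltr_wpDl ?sqr_ge0.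
(* With this small [s], [key] would give [2 * e <= e * m ^+ 2 / (m ^+ 2 + 1)], which is false for
   [e > 0]. *)
have := key (e / (m ^+ 2 + 1)) (divr_gt0 e0 m1).
rewrite -mulrA -/e mulrAC ler_pdivlMr//; apply/negP; rewrite -ltNge.
have := sqr_ge0 m; nra.
Qed.

(* The maps T + i t, t >= 0, are bounded below uniformly in t, so surjectivity
   propagates from large t down to t = 0 in steps of fixed length. *)
Lemma self_adjoint_bounded_below_surjective (M k : R) : 0 < k ->
  (forall x, rnorm (T x) <= M * rnorm x) ->
  (forall x, k * rnorm x <= rnorm (T x)) -> forall z, exists x, T x = z.
Proof.
move=> k0 TM kT.
pose U (t : R) x := T x + (t *i) *: x.
have UB t : {morph U t : x y / x - y}.
  by move=> x y; rewrite /U linearB scalerBr opprD addrACA.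
(* Average of the lower bounds [t * rnorm x] and [(k - t) * rnorm x]. *)
have below (t : R) x : 0 <= t -> k / 2 * rnorm x <= rnorm (U t x).
  move=> t0; have h1 := rnorm_add_imaginary t x.
  have h2 := lerB_rnormD (T x) ((t *i) *: x).
  rewrite rnormZi ger0_norm// in h2.
  have h3 := kT x; rewrite /U; lra.
have half01 : 0 <= (2^-1 : R) < 1 by lra.
(* A step of [k / 4] is half the lower bound [k / 2], giving contraction ratio 1/2. *)
pose t n := n%:R * (k / 4).
have t0 n : 0 <= t n by rewrite mulr_ge0// divr_ge0// ltW.
have descent n : (forall z, exists x, U (t n.+1) x = z) ->
    forall z, exists x, U (t n) x = z.
  move=> surj; apply: (perturbed_surjective half01 (UB _) (UB _) _ surj) => x.
  have -> : U (t n) x - U (t n.+1) x = ((- (k / 4)) *i) *: x.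
    rewrite /U opprD addrACA subrr add0r -scalerBl; congr (_ *: _).
    apply/eqP; rewrite eq_complex /= /t -natr1; apply/andP.
    by split; apply/eqP; ring.
  rewrite rnormZi normrN gtr0_norm ?divr_gt0//.
  have := below (t n.+1) x (t0 _); lra.
(* Beyond [2 * M], [T] is a perturbation of the invertible scalar i t with ratio 1/2. *)
have [N MN] : exists N, 2 * M / (k / 4) < N.+1%:R.
  by exists (Num.truncn (2 * M / (k / 4))); rewrite truncnS_gt.
have MtN : 2 * M < t N.+1 by move: MN; rewrite ltr_pdivrMr ?divr_gt0.
have tN0 : 0 < t N.+1 by rewrite mulr_gt0 ?divr_gt0.
have start z : exists x, U (t N.+1) x = z.
  have scaleB : {morph (fun x : H => ((t N.+1) *i) *: x) : x y / x - y}.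
    by move=> x y; rewrite scalerBr.
  apply: (perturbed_surjective half01 scaleB (UB _)) => [x|{}z].
    rewrite /U addrK rnormZi gtr0_norm// (le_trans (TM x))//.
    by rewrite mulrA ler_wpM2r ?rnorm_ge0//; lra.
  exists (((t N.+1) *i)^-1 *: z); rewrite scalerA divff ?scale1r//.
  by rewrite eq_complex /= eqxx/= gt_eqF.
have : forall z, exists x, U (t 0%N) x = z.
  by elim: N.+1 start {MN MtN tN0} => // n ih start; apply: ih; apply: descent.
move=> surj z; have [x <-] := surj z; exists x.
by rewrite /U /t mul0r (_ : 0 *i = 0) ?scale0r ?addr0//.
Qed.

End Surjectivity.

(** * Adjointable right inverses and composition *)

Section RightInverse.
Context {R : realType} {A : cstarAlgType R}.

(** Writing [z = phi x] turns [inner y z] into [inner (phis y) x], so the set where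
    [rnorm (phis y) <= 1] is weakly bounded, hence bounded; scaling does the rest. *)
Lemma surjective_adjoint_bounded_below (H1 H : hilbertModType A)
    (phi : H1 -> H) (phis : {linear H -> H1}) :
  (forall x y, inner (phi x) y = inner x (phis y)) ->
  (forall y, exists x, phi x = y) ->
  exists2 k : R, 0 < k & forall y, k * rnorm y <= rnorm (phis y).
Proof.
move=> adj surj.
have adj' x y : inner (phis y) x = inner y (phi x).
  by rewrite -inner_conj_sym -adj inner_conj_sym.
have [|M SM] := @weakly_bounded_bounded R A H [set y | rnorm (phis y) <= 1]%classic.
  move=> z; have [x <-] := surj z; exists (6 * rnorm x) => y /= y1.
  rewrite -adj' (le_trans (rnorm_inner_le _ _))// ler_wpM2r ?rnorm_ge0//.
  by rewrite ler_piMr.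
have M0 : 0 <= M.
  by rewrite -(rnorm0 (V := H)); apply: SM; rewrite /= linear0 rnorm0.
have scaled (r : R) y : 0 < r -> rnorm (phis y) <= r -> rnorm y <= M * r.
  move=> r0 yr; have /= := SM (r^-1%:C *: y).
  rewrite linearZ/= !rnormZr gtr0_norm ?invr_gt0// ler_pdivrMl// mulr1.
  by move=> /(_ yr); rewrite ler_pdivrMl// mulrC.
(* [M] may be 0, hence the added 1. *)
exists (M + 1)^-1 => [|y]; first by rewrite invr_gt0 ltr_wpDl.
rewrite ler_pdivrMl ?ltr_wpDl//.
have [p0|p0] := ltP 0 (rnorm (phis y)).
  by rewrite (le_trans (scaled _ _ p0 (lexx _)))// ler_wpM2r ?lerDl// ltW.
rewrite leNgt; apply/negP => h.
have y0 : 0 < rnorm y by rewrite (le_lt_trans _ h)// mulr_ge0 ?rnorm_ge0// addr_ge0.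
(* Here [phis y] vanishes, so [scaled] applies to every positive radius; this one forces
   [M + 1 <= M]. *)
have r0 : 0 < rnorm y / (M + 1) by rewrite divr_gt0// ltr_wpDl.
have := scaled _ _ r0 (le_trans p0 (ltW r0)).
rewrite mulrCA ler_pMr// ler_pdivlMr ?ltr_wpDl// mul1r.
by rewrite gerDl ler10.
Qed.

Lemma linear_of_right_inverse (V W : lmodType R[i]) (T : {linear V -> W}) (g : W -> V) :
  injective T -> cancel g T -> linear g.
Proof. by move=> Tinj gK k x y; apply: Tinj; rewrite linearP !gK. Qed.

Lemma adjointable_right_inverse (H1 H : hilbertModType A) (phi : {linear H1 -> H}) :
  adjointable phi -> (forall y, exists x, phi x = y) ->
  exists psi : {linear H -> H1}, adjointable psi /\ forall y, phi (psi y) = y.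
Proof.
move=> [[phi_ract [M phiM]] [phis [[phis_ract [Ms phisM]] adj]]] surj.
have adj' x y : inner (phis y) x = inner y (phi x).
  by rewrite -inner_conj_sym -adj inner_conj_sym.
have [k k0 kphis] := surjective_adjoint_bounded_below adj surj.
pose T : {linear H -> H} := phi \o phis.
have Tself x y : inner (T x) y = inner x (T y) by rewrite /= adj adj'.
(* A bound given by [bounded_module_map] may be negative; its absolute value can be multiplied
   through inequalities. *)
have bounded (H3 H4 : hilbertModType A) (f : H3 -> H4) (B : R) :
    (forall x, `|f x| <= B%:C * `|x|) -> forall x, rnorm (f x) <= `|B| * rnorm x.
  move=> fB x; have := fB x; rewrite !rnormE -rmorphM lecR => /le_trans; apply.
  by rewrite ler_wpM2r ?rnorm_ge0 ?ler_norm.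
have TM x : rnorm (T x) <= `|M| * `|Ms| * rnorm x.
  apply: (le_trans (bounded _ _ _ _ phiM _)).
  by rewrite -mulrA ler_wpM2l ?(bounded _ _ _ _ phisM).
have [c c0 cT] : exists2 c : R, 0 < c & forall x, c * rnorm x <= rnorm (T x).
  (* From [(k * rnorm x) ^+ 2 <= rnorm (phis x) ^+ 2 = rnorm (inner (T x) x) <= 6 * rnorm (T x) *
     rnorm x]. *)
  exists (k ^+ 2 / 6) => [|x]; first by rewrite divr_gt0 ?exprn_gt0.
  have [->|x0] := eqVneq x 0; first by rewrite rnorm0 mulr0 rnorm_ge0.
  rewrite -rnorm_gt0 in x0; rewrite -(ler_pM2r x0).
  have h1 := rnorm_inner_le (T x) x.
  rewrite /= adj rnorm_inner_self in h1.
  have h2 : (k * rnorm x) ^+ 2 <= rnorm (phis x) ^+ 2.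
    by rewrite ler_sqr ?nnegrE ?rnorm_ge0 ?mulr_ge0 ?rnorm_ge0// ltW.
  rewrite /=; lra.
have /choice[g gK] := self_adjoint_bounded_below_surjective Tself c0 TM cT.
have Tinj : injective T.
  move=> x y Txy; apply/eqP; rewrite -subr_eq0 -[_ == 0]negbK -rnorm_gt0 -leNgt.
  by rewrite -(pmulr_rle0 _ c0) (le_trans (cT _))// linearB Txy subrr rnorm0.
have [G GK] : exists G : {linear H -> H}, forall y, T (G y) = y.
  pose gL := GRing.isLinear.Build _ _ _ _ g (linear_of_right_inverse Tinj gK).
  pose G : {linear H -> H} := HB.pack g gL.
  by exists G.
have G_ract x a : G (ract x a) = ract (G x) a.
  by apply: Tinj; rewrite GK /= phis_ract phi_ract; congr (ract _ _); exact/esym/GK.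
have GM x : rnorm (G x) <= c^-1 * rnorm x.
  by rewrite ler_pdivlMl// (le_trans (cT _))// GK.
have bounded_map (H3 H4 : hilbertModType A) (f : H3 -> H4) (B : R) :
    (forall x, rnorm (f x) <= B * rnorm x) -> forall x, `|f x| <= B%:C * `|x|.
  by move=> fB x; rewrite !rnormE -rmorphM lecR.
exists (phis \o G); split; last by move=> y /=; exact: GK.
split.
  split=> [x a|]; first by rewrite /= G_ract phis_ract.
  exists (`|Ms| * c^-1); apply: bounded_map => x /=.
  by rewrite (le_trans (bounded _ _ _ _ phisM _))// -mulrA ler_wpM2l.
(* The inverse [G] of the self-adjoint [T] is self-adjoint, so the adjoint of [phis \o G] is
   [G \o phi]. *)
exists (G \o phi); split; last first.
  by move=> x y; rewrite /= adj' -{1}(GK (phi y)) -Tself GK.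
split=> [x a|]; first by rewrite /= phi_ract G_ract.
exists (c^-1 * `|M|); apply: bounded_map => x /=.
by rewrite (le_trans (GM _))// -mulrA ler_wpM2l ?(bounded _ _ _ _ phiM)// invr_ge0 ltW.
Qed.

Lemma bounded_module_map_comp (H1 H2 H3 : hilbertModType A)
    (S : {linear H2 -> H3}) (T : {linear H1 -> H2}) :
  bounded_module_map S -> bounded_module_map T -> bounded_module_map (S \o T).
Proof.
move=> [S_ract [MS SM]] [T_ract [MT TM]]; split=> [x a|].
  by rewrite /= T_ract S_ract.
exists (`|MS| * MT) => x /=; rewrite rmorphM -mulrA.
apply: (le_trans (SM _)); apply: (@le_trans _ _ (`|MS|%:C * `|T x|)).
  by rewrite ler_wpM2r// lecR ler_norm.
by rewrite ler_wpM2l// ler0c.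
Qed.

Lemma adjointable_comp (H1 H2 H3 : hilbertModType A)
    (S : {linear H2 -> H3}) (T : {linear H1 -> H2}) :
  adjointable S -> adjointable T -> adjointable (S \o T).
Proof.
move=> [Sb [Ss [Ssb Sadj]]] [Tb [Ts [Tsb Tadj]]].
split; first exact: bounded_module_map_comp.
exists (Ts \o Ss); split; first exact: bounded_module_map_comp.
by move=> x y; rewrite /= Sadj Tadj.
Qed.

End RightInverse.

Theorem theorem3p4 (R : realType) (A : cstarAlgType R) (H : hilbertModType A) :
  (forall (H1 : hilbertModType A) (phi : {linear H1 -> H}),
     adjointable phi -> (forall y : H, exists x : H1, phi x = y) ->
     exists psi : {linear H -> H1},
       adjointable psi /\ forall y : H, phi (psi y) = y) /\
  (forall (H2 H3 : hilbertModType A)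
     (phi1 : {linear H2 -> H3}) (phi2 : {linear H -> H3}),
     adjointable phi1 -> (forall z : H3, exists x : H2, phi1 x = z) ->
     adjointable phi2 ->
     exists psi : {linear H -> H2},
       adjointable psi /\ forall y : H, phi1 (psi y) = phi2 y).
Proof.
split=> [H1 phi phiL surj|H2 H3 phi1 phi2 phi1L surj phi2L].
  exact: adjointable_right_inverse.
(* Part (2) follows from part (1) for the module [H3]: a right inverse of [phi1] is composed with
   [phi2]. *)
have [psi [psiL phi1K]] := adjointable_right_inverse phi1L surj.
by exists (psi \o phi2); split=> [|y]; [exact: adjointable_comp | exact: phi1K].
Qed.
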